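(* Let $\beta\ge1$, $k'>0$, and let $(x^t,y^t)_{t=1}^T$, $x^t\in\mathbb{R}^M_{\ge0}$, $y^t\in\mathbb{R}^{M\times C^t}_{\ge0}$, be a fractional solution to fully dynamic $k$-median revealed online, satisfying for every $t$: $\sum_{i\in M}y^t_{ij}\ge1$ for $j\in C^t$; $y^t_{ij}\le x^t_i$; $\sum_{i\in M}x_i^t\le k'$; and $\sum_{i\in M,j\in C^t}d_{ij}y^t_{ij}\le\beta\,\mathrm{OPT}^t$. Let $R=\sum_{t=1}^T\|x^t-x^{t-1}\|_1$ with $x^0=0$. Then there is an online algorithm that maintains an integral solution $S^t\subseteq M$ with $|S^t|\le\alpha k'$ and $\sum_{j\in C^t}\min_{i\in S^t}d_{ij}\le\alpha\beta\,\mathrm{OPT}^t$ at every time $t$, where $\alpha=11$, and whose total recourse $\sum_t|S^t\oplus S^{t-1}|$ is $O(\log\Delta)\cdot R$.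
   Context: $(M,d)$ is a finite metric space with minimum nonzero distance $1$ and maximum distance $\Delta$ (aspect ratio). At each time $t$ a set of clients $C^t\subseteq M$ is present. $\mathrm{OPT}^t$ denotes the optimal value at time $t$ of the fractional $k$-median LP: minimize $\sum_{i,j}d_{ij}y_{ij}$ subject to $\sum_i y_{ij}\ge1$ for $j\in C^t$, $0\le y_{ij}\le x_i$, $\sum_i x_i\le k$. The integral algorithm sees $(x^t,y^t)$ only at time $t$. *)

(* Defs.v *)
From HB Require Import structures.
From mathcomp Require Import all_boot all_order all_algebra.
From mathcomp Require Import mathcomp_extra boolp classical_sets.
From mathcomp Require Import reals ereal exp.

Set Implicit Arguments.
Unset Strict Implicit.
Unset Printing Implicit Defensive.

Import Order.TTheory GRing.Theory Num.Theory.
Local Open Scope classical_set_scope.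
Local Open Scope ring_scope.

Section FiniteMetric.
Variables (R : realType) (M : finType).

(* The axioms are those of the library factory [isMetric]; an explicit distance
   is used because [metricType] also carries a topology and has no join with
   [finType]. *)
Record is_metric (d : M -> M -> R) : Prop := IsMetric {
  metricxx : forall i, d i i = 0 ;
  metric_positivity : forall i j, d i j = 0 -> i = j ;
  metric_sym : forall i j, d i j = d j i ;
  metric_triangle : forall i j l, d i l <= d i j + d j l }.

(* The existence clause forces M to have at least two points. *)
Definition min_nonzero_distance (d : M -> M -> R) (m : R) : Prop :=
  (exists i j, i != j /\ d i j = m) /\ (forall i j, i != j -> m <= d i j).

Definition max_distance (d : M -> M -> R) : R :=
  \big[Order.max/0]_(i : M) \big[Order.max/0]_(j : M) d i j.

End FiniteMetric.

Section KMedian.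
Variables (R : realType) (M : finType) (d : M -> M -> R).

(* In every [y : M -> M -> R] below, [y i j] is the amount of client [j] served
   by facility [i]. Only the values at clients [j \in C] are ever constrained or
   counted, so [y] stands for a vector indexed by M x C. *)

Definition assignment_cost (C : {set M}) (y : M -> M -> R) : R :=
  \sum_(i : M) \sum_(j in C) d i j * y i j.

Definition covers (C : {set M}) (y : M -> M -> R) : Prop :=
  forall j, j \in C -> 1 <= \sum_(i : M) y i j.

Definition lp_feasible (k : nat) (C : {set M}) (x : M -> R) (y : M -> M -> R) :
    Prop :=
  [/\ covers C y,
      forall i j, j \in C -> 0 <= y i j <= x i
    & \sum_(i : M) x i <= k%:R].

(* Equal to [+oo] when the linear program is infeasible, i.e. when k = 0 and C is
   nonempty. *)
Definition OPT (k : nat) (C : {set M}) : \bar R :=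
  ereal_inf [set v | exists x y,
    lp_feasible k C x y /\ v = (assignment_cost C y)%:E].

(* The minimum over an empty S is [+oo]. *)
Definition connection_cost (C S : {set M}) : \bar R :=
  (\sum_(j in C) \big[Order.min/+oo]_(i in S) (d i j)%:E)%E.

End KMedian.

Section Online.
Variables (R : realType) (M : finType).

Record frac_step := FracStep {
  clients : {set M} ;
  frac_x : M -> R ;
  frac_y : M -> M -> R }.

Definition frac_valid (d : M -> M -> R) (k : nat) (beta k' : R)
    (s : frac_step) : Prop :=
  (forall i, 0 <= frac_x s i) /\
  (forall i j, j \in clients s -> 0 <= frac_y s i j) /\
  covers (clients s) (frac_y s) /\
  (forall i j, j \in clients s -> frac_y s i j <= frac_x s i) /\
  \sum_(i : M) frac_x s i <= k' /\
  ((assignment_cost d (clients s) (frac_y s))%:E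
     <= beta%:E * OPT d k (clients s))%E.

(* A deterministic online algorithm: it maps the history (s_1, ..., s_t) to the
   solution S^t, so S^t cannot depend on later steps nor on the horizon. *)
Definition online_algorithm := seq frac_step -> {set M}.

(* Inputs are indexed from 1; the value at index 0 is never read. *)
Definition run (A : online_algorithm) (s : nat -> frac_step) (t : nat) :
    {set M} :=
  if t == 0%N then finset.set0 else A [seq s u | u <- iota 1 t].

Definition frac_x_at (s : nat -> frac_step) (t : nat) (i : M) : R :=
  if t == 0%N then 0 else frac_x (s t) i.

Definition frac_recourse (s : nat -> frac_step) (T : nat) : R :=
  \sum_(1 <= t < T.+1) \sum_(i : M) `|frac_x_at s t i - frac_x_at s t.-1 i|.

Definition symdiff (A B : {set M}) : {set M} := (A :\: B) :|: (B :\: A).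

Definition recourse (S : nat -> {set M}) (T : nat) : nat :=
  (\sum_(1 <= t < T.+1) #|symdiff (S t) (S t.-1)|)%N.

End Online.

(* Main.v *)
Require Import Defs.
From HB Require Import structures.
From mathcomp Require Import all_boot all_order all_algebra.
From mathcomp Require Import mathcomp_extra boolp classical_sets.
From mathcomp Require Import reals ereal exp.
From mathcomp Require Import fintype finset ring lra.

Set Implicit Arguments.
Unset Strict Implicit.
Unset Printing Implicit Defensive.

Import Order.TTheory GRing.Theory Num.Theory.
Local Open Scope ring_scope.

(** Call a ball of radius 0, 1, 2, 4, ..., 2^L (with 2^L at least the diameter)
    heavy when its fractional mass is at least 1/2. By Markov's inequality a
    client of fractional cost c is the centre of a heavy ball of radius at most
    4c, so the integral cost is at most 8 times the fractional one as soon as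
    every heavy ball of radius r has a centre of S within 2r of its own centre.
    The algorithm inserts the centres of heavy balls that violate this, by
    increasing radius; when S would exceed 11k' points it restarts from the
    empty set, with threshold 1/4 instead of 1/2. The balls inserted by a restart
    are disjoint, so at most 4k' points are inserted.

    A ball inserted between two restarts had mass less than 1/4 at the last
    restart, so at least 1/4 of mass has moved inside it since, and the balls
    inserted at one scale are disjoint. Hence the insertions of a phase are at
    most 4(L+2) times the fractional movement of the phase. A restart changes at
    most 15k' points and is preceded by more than 7k' insertions, counting those
    that trigger it. *)

(** * Mass of balls, and packing of disjoint balls *)

Section BallMass.
Variables (R : realType) (M : finType) (d : M -> M -> R).
Hypothesis metric_d : is_metric d.

Definition ball_mass (x : M -> R) (j : M) (r : R) : R :=
  \sum_(i | d i j <= r) x i.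

Lemma dist_ge0 i j : 0 <= d i j.
Proof.
have := Defs.metric_triangle metric_d i j i.
rewrite (Defs.metricxx metric_d) (Defs.metric_sym metric_d j i); lra.
Qed.

Lemma ball_mass_le (x y : M -> R) j r :
  (forall i, x i <= y i) -> ball_mass x j r <= ball_mass y j r.
Proof. by move=> xy; apply: ler_sum. Qed.

(** By the triangle inequality no point lies in two of the balls, so exchanging the sums counts each
    [w a] at most once. *)
Lemma sum_disjoint_balls (w : M -> R) (I : {set M}) (r : M -> R) :
    (forall a, 0 <= w a) ->
    {in I &, forall i j, i != j -> r i + r j < d i j} ->
  \sum_(i in I) ball_mass w i (r i) <= \sum_a w a.
Proof.
move=> w0 sep; rewrite /ball_mass.
under eq_bigr do rewrite big_mkcond /=.
rewrite exchange_big /=; apply: ler_sum => a _.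
rewrite -big_mkcondr /= sumr_const.
set n := #|_|; suff : (n <= 1)%N.
  by case: n => [|[|//]] _; rewrite ?mulr0n ?mulr1n.
apply/card_le1_eqP => j i /andP[jI aj] /andP[iI ai].
apply/eqP; apply/negPn/negP => ij; have := sep i j iI jI ij.
have := Defs.metric_triangle metric_d i a j; rewrite (Defs.metric_sym metric_d i a); lra.
Qed.

Lemma card_heavy_disjoint_balls (w : M -> R) (I : {set M}) (r : M -> R) theta :
    (forall a, 0 <= w a) ->
    {in I &, forall i j, i != j -> r i + r j < d i j} ->
    {in I, forall i, theta <= ball_mass w i (r i)} ->
  theta * #|I|%:R <= \sum_a w a.
Proof.
move=> w0 sep heavy; apply: le_trans (sum_disjoint_balls w0 sep).
by rewrite mulr_natr -sumr_const; apply: ler_sum.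
Qed.

End BallMass.

(** * Geometric radii *)

Section Scales.
Variable R : realType.

(** Scale 0 is a single point: a client of very small fractional cost must have a facility at
    distance 0. *)
Definition radius (l : nat) : R := if l is l'.+1 then 2 ^+ l' else 0.

Lemma radius_ge0 l : 0 <= radius l.
Proof. by case: l => //= l; rewrite exprn_ge0. Qed.

Lemma le_radius : {homo radius : l m / (l <= m)%N >-> l <= m}.
Proof.
case=> [|l] [|m] lm //=; rewrite ?lexx ?exprn_ge0 //.
by rewrite ler_weXn2l // ler1n.
Qed.

Lemma ln2_gt0 : 0 < ln (2 : R).
Proof. by rewrite ln_gt0 ?ltr1n. Qed.

Definition top_scale (D : R) : nat := (Num.truncn (ln D / ln 2)).+1.

Lemma le_pow2_top_scale (D : R) : 1 <= D -> D <= 2 ^+ top_scale D.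
Proof.
move=> D1; have D0 : 0 < D by lra.
rewrite -ler_ln ?posrE ?exprn_gt0 // lnXn // -[_ *+ top_scale D]mulr_natl.
by rewrite -ler_pdivrMr ?ln2_gt0 //; apply/ltW/truncnS_gt.
Qed.

Lemma top_scale_le (D : R) : 1 <= D -> (top_scale D)%:R <= 1 + ln D / ln 2.
Proof.
move=> D1; rewrite /top_scale -natr1 addrC lerD2l truncn_le //.
by rewrite divr_ge0 ?ln_ge0 ?ler1n.
Qed.

End Scales.

(** * Greedy insertion of centres of heavy balls *)

Section Augment.
Variables (R : realType) (M : finType) (d : M -> M -> R).
Hypothesis metric_d : is_metric d.
Variable L : nat.
Local Notation scale := 'I_L.+2.
Local Notation radius := (radius R).

(** The factor 2 makes balls of equal radius around inserted centres disjoint. *)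
Definition near (S : {set M}) (j : M) (r : R) : bool :=
  [exists i in S, d i j <= 2 * r].

Definition insert (theta : R) (x : M -> R) (S : {set M}) (p : scale * M) :
    {set M} :=
  if (theta <= ball_mass d x p.2 (radius p.1)) && ~~ near S p.2 (radius p.1)
  then p.2 |: S else S.

Definition scan : seq (scale * M) :=
  sort (fun p q : scale * M => p.1 <= q.1)%N (enum {: scale * M}).

Definition augment (theta : R) (x : M -> R) (S : {set M}) : {set M} :=
  foldl (insert theta x) S scan.

Definition heavy_covered (theta : R) (x : M -> R) (S : {set M}) : Prop :=
  forall (l : scale) j,
    theta <= ball_mass d x j (radius l) -> near S j (radius l).

Lemma near_sub (S S' : {set M}) j r : S \subset S' -> near S j r -> near S' j r.
Proof.
move=> /subsetP sub /existsP[i /andP[iS ij]].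
by apply/existsP; exists i; rewrite sub.
Qed.

Lemma nearPn (S : {set M}) j r : ~~ near S j r -> {in S, forall i, 2 * r < d i j}.
Proof.
move=> nnear i iS; rewrite ltNge; apply: contra nnear => ij.
by apply/existsP; exists i; rewrite iS.
Qed.

Lemma heavy_covered_le theta theta' x S :
  theta <= theta' -> heavy_covered theta x S -> heavy_covered theta' x S.
Proof. by move=> tt' cov l j /(le_trans tt')/cov. Qed.

(** [tag i] is the scale at which [i] was inserted, which the algorithm does not store.
    [augmentation_sep] applies to both orders of a pair, so the distance exceeds twice the larger
    radius. *)
Record augmentation (theta : R) (x : M -> R) (S S' : {set M})
    (tag : M -> scale) : Prop := Augmentation {
  augmentation_sub : S \subset S' ;
  augmentation_heavy : {in S' :\: S, forall i,
    theta <= ball_mass d x i (radius (tag i))} ;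
  augmentation_far : {in S & S' :\: S, forall i' i, 2 * radius (tag i) < d i' i} ;
  augmentation_sep : {in S' :\: S &, forall i i', i != i' ->
    2 * radius (tag i) < d i i'} }.

(** Induction on the last pair scanned. Its scale is the largest so far, so failing to be near at
    its own radius also separates its centre from earlier ones at their smaller radii. *)
Lemma foldl_insertP theta x S (ps : seq (scale * M)) :
    0 < theta -> pairwise (fun p q : scale * M => p.1 <= q.1)%N ps ->
  let S' := foldl (insert theta x) S ps in
  (forall p, p \in ps -> theta <= ball_mass d x p.2 (radius p.1) ->
     near S' p.2 (radius p.1)) /\
  exists2 tag, augmentation theta x S S' tag &
    {in S' :\: S, forall i, (tag i, i) \in ps}.
Proof.
move=> theta0; elim/last_ind: ps => [_ /=|ps [l j] IH].
  split=> //; exists (fun=> ord0); last by move=> i; rewrite setDv inE.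
  by split=> // [i|i i' _|i i']; rewrite setDv inE.
rewrite pairwise_rcons foldl_rcons => /andP[/allP le_l /IH] /=.
set S1 := foldl _ _ _ => -[cov [tag [sub heavy far sep] tagP]].
rewrite /insert /=; case: ifP => [/andP[hv /nearPn nnear]|hv]; last first.
  split=> [[l' j']|].
    rewrite mem_rcons inE => /predU1P[[-> ->]/= h|/cov//].
    by move/negbT: hv; rewrite h /= negbK.
  by exists tag => // i /tagP; rewrite mem_rcons inE orbC => ->.
have jS1 : j \notin S1.
  apply/negP => /nnear; rewrite (Defs.metricxx metric_d) ltNge.
  by rewrite mulr_ge0 ?radius_ge0.
have jS : j \notin S by apply: contra jS1; apply: (subsetP sub).
have newE i : (i \in (j |: S1) :\: S) -> i = j \/ (i != j /\ i \in S1 :\: S).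
  rewrite !inE; case: eqVneq => [->|_] /=; [by left|by right].
have sub1 : S1 \subset j |: S1 by rewrite subsetU1.
split=> [[l' j']|].
  rewrite mem_rcons inE => /predU1P[[-> ->]/= _|/cov c /c/(near_sub sub1)//].
  apply/existsP; exists j; rewrite setU11 (Defs.metricxx metric_d).
  by rewrite mulr_ge0 ?radius_ge0.
exists (fun i => if i == j then l else tag i).
  split.
  - exact: subset_trans sub sub1.
  - by move=> i /newE[->|[/negPf-> /heavy//]]; rewrite eqxx.
  - move=> i' i i'S /newE[->|[/negPf-> /(far _ _ i'S)//]]; rewrite eqxx.
    exact/nnear/(subsetP sub).
  - move=> i i' /newE[->|[ij iS]] /newE[->|[i'j i'S]] ii'.
    + by rewrite eqxx in ii'.
    + rewrite eqxx (Defs.metric_sym metric_d) nnear //.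
      by move: i'S; rewrite inE => /andP[].
    + rewrite (negPf ij) (le_lt_trans _ (nnear i _)) //.
        by rewrite ler_pM2l // le_radius // (le_l (tag i, i)) // tagP.
      by move: iS; rewrite inE => /andP[].
    + by rewrite (negPf ij) sep.
move=> i /newE[->|[/negPf-> /tagP h]]; rewrite mem_rcons inE ?eqxx //.
by rewrite h orbT.
Qed.

Lemma augmentP theta x S : 0 < theta ->
  heavy_covered theta x (augment theta x S) /\
  exists tag, augmentation theta x S (augment theta x S) tag.
Proof.
move=> theta0.
have srt : pairwise (fun p q : scale * M => p.1 <= q.1)%N scan.
  rewrite -sorted_pairwise; last by move=> p q r; apply: leq_trans.
  by apply: sort_sorted => p q; apply: leq_total.
have [cov [tag aug _]] := foldl_insertP x S theta0 srt.
split; last by exists tag.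
by move=> l j; apply: (cov (l, j)); rewrite mem_sort mem_enum.
Qed.

Lemma augment_set0_card theta x : 0 < theta -> (forall i, 0 <= x i) ->
  theta * #|augment theta x set0|%:R <= \sum_i x i.
Proof.
move=> theta0 x0; have [_ [tag [_ heavy _ sep]]] := augmentP x set0 theta0.
rewrite setD0 in heavy sep.
apply: (card_heavy_disjoint_balls metric_d (r := fun i => radius (tag i))) => //.
move=> i j iS jS ij; have := sep _ _ iS jS ij.
by have := sep _ _ jS iS; rewrite eq_sym ij (Defs.metric_sym metric_d) => /(_ isT); lra.
Qed.

End Augment.

(** * The online algorithm and its phases *)

Section Rounding.
Variables (R : realType) (M : finType) (d : M -> M -> R).
Hypothesis metric_d : is_metric d.
Variables (L : nat) (k' : R).
Hypothesis k'_gt0 : 0 < k'.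
Local Notation scale := 'I_L.+2.
Local Notation radius := (radius R).

Definition rounding_step (S : {set M}) (s : frac_step R M) : {set M} :=
  let S' := augment d L 2^-1 (frac_x s) S in
  if #|S'|%:R <= 11 * k' then S' else augment d L 4^-1 (frac_x s) set0.

Definition rounding : online_algorithm R M := foldl rounding_step set0.

Lemma run_roundingS s t :
  run rounding s t.+1 = rounding_step (run rounding s t) (s t.+1).
Proof.
have -> : run rounding s t = rounding [seq s u | u <- iota 1 t] by case: t.
rewrite -[LHS]/(rounding [seq s u | u <- iota 1 t.+1]).
have -> : iota 1 t.+1 = iota 1 t ++ [:: t.+1].
  by rewrite -[t.+1]addn1 iotaD add1n addn1.
by rewrite map_cat /rounding foldl_cat.
Qed.

Lemma rounding_step_covered S s :
  heavy_covered d L 2^-1 (frac_x s) (rounding_step S s).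
Proof.
have h0 : 0 < 2^-1 :> R by lra.
have q0 : 0 < 4^-1 :> R by lra.
rewrite /rounding_step; case: ifP => _.
  by have [] := augmentP metric_d L (frac_x s) S h0.
have [cov _] := augmentP metric_d L (frac_x s) set0 q0.
by apply: heavy_covered_le cov; lra.
Qed.

(* [xb] and [Sb] are the fractional and the integral solution at the last
   restart, [m i] is the total movement of coordinate [i] since then and [tag i]
   is the scale at which [i] was inserted since then. *)
Record phase (x : M -> R) (S : {set M}) (m xb : M -> R) (Sb : {set M})
    (tag : M -> scale) : Prop := Phase {
  phase_sub : Sb \subset S ;
  phase_card : #|Sb|%:R <= 4 * k' ;
  phase_covered : heavy_covered d L 4^-1 xb Sb ;
  phase_move : forall i, `|x i - xb i| <= m i ;
  phase_heavy : {in S :\: Sb, forall i,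
    4^-1 <= ball_mass d m i (radius (tag i))} ;
  phase_sep : {in S :\: Sb &, forall i i', i != i' -> tag i = tag i' ->
    2 * radius (tag i) < d i i'} }.

Lemma phase_insertions x S m xb Sb tag : phase x S m xb Sb tag ->
  #|S :\: Sb|%:R <= 4 * L.+2%:R * \sum_i m i.
Proof.
case=> _ _ _ mv heavy sep; set I := S :\: Sb.
have m0 i : 0 <= m i by apply: le_trans (mv i).
have -> : #|I|%:R = \sum_(l : scale) #|[set i in I | tag i == l]|%:R :> R.
  rewrite -natr_sum -sum1_card (partition_big tag predT) //=; congr _%:R.
  by apply: eq_bigr => l _; rewrite sum1dep_card; apply: eq_card => i; rewrite !inE.
(* The factor [L.+2] becomes a sum over the scales. At each scale the balls are disjoint and each
   holds movement at least 1/4. *)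
rewrite mulrAC -[L.+2 in X in _ <= X]card_ord mulr_natr -sumr_const.
apply: ler_sum => l _.
have := @card_heavy_disjoint_balls _ _ _ metric_d m [set i in I | tag i == l]
  (fun i => radius (tag i)) 4^-1 m0.
move=> H; suff : 4^-1 * #|[set i in I | tag i == l]|%:R <= \sum_a m a by lra.
apply: H => [i j|i]; rewrite !inE.
  move=> /andP[iI /eqP il] /andP[jI /eqP jl] ij.
  have := sep i j; rewrite !inE il jl => /(_ iI jI ij erefl); lra.
by move=> /andP[iI _]; apply: heavy; rewrite inE.
Qed.

(** Old points keep their tags, and their balls only gain movement. A new point is far from all of
    [S] at its own scale, which separates it from old points with the same tag. *)
Lemma phase_augment x x' S m xb Sb tag : phase x S m xb Sb tag ->
  exists tag', phase x' (augment d L 2^-1 x' S)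
    (fun i => m i + `|x' i - x i|) xb Sb tag'.
Proof.
case=> sub card cov mv heavy sep.
have h0 : 0 < 2^-1 :> R by lra.
have [_ [ntag [nsub nheavy nfar nsep]]] := augmentP metric_d L x' S h0.
set S' := augment _ _ _ _ _ in nsub nheavy nfar nsep *.
have mv' i : `|x' i - xb i| <= m i + `|x' i - x i|.
  have -> : x' i - xb i = (x i - xb i) + (x' i - x i) by ring.
  by apply: le_trans (ler_normD _ _) _; rewrite lerD2r.
exists (fun i => if i \in S then tag i else ntag i); split=> //.
- exact: subset_trans sub nsub.
- move=> i; rewrite inE => /andP[iSb iS']; case: ifPn => iS.
    have := heavy i; rewrite inE iSb iS => /(_ isT)/le_trans; apply.
    by apply: ball_mass_le => a; rewrite lerDl.
  have iN : i \in S' :\: S by rewrite inE iS.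
  (* Otherwise [Sb] would have a point near [i]; as [Sb] is contained in [S], this contradicts
     [nfar]. The ball thus rose from below 1/4 to at least 1/2. *)
  have light : ball_mass d xb i (radius (ntag i)) < 4^-1.
    rewrite ltNge; apply/negP => /cov /existsP[b /andP[bSb bi]].
    by have := nfar b i (subsetP sub b bSb) iN; rewrite ltNge bi.
  have := nheavy i iN.
  have : ball_mass d x' i (radius (ntag i)) <= ball_mass d xb i (radius (ntag i))
     + ball_mass d (fun i => m i + `|x' i - x i|) i (radius (ntag i)).
    rewrite -big_split /=; apply: ler_sum => a _.
    have := ler_norm (x' a - xb a); have := mv' a; lra.
  lra.
- move=> i i'; rewrite !inE => /andP[iSb iS'] /andP[i'Sb i'S'] ii'.
  case: ifPn => iS; case: ifPn => i'S eq_tag.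
  + by apply: sep; rewrite ?inE ?iSb ?i'Sb.
  + by rewrite eq_tag; apply: nfar => //; rewrite inE i'S.
  + by rewrite (Defs.metric_sym metric_d); apply: nfar => //; rewrite inE iS.
  + by apply: nsep => //; rewrite inE ?iS ?i'S.
Qed.

Lemma phase_restart x : (forall i, 0 <= x i) -> \sum_i x i <= k' ->
  let S := augment d L 4^-1 x set0 in
  phase x S (fun=> 0) x S (fun=> ord0).
Proof.
move=> x0 xk S; have q0 : 0 < 4^-1 :> R by lra.
split=> //.
- have := augment_set0_card metric_d L q0 x0; rewrite -/S; lra.
- by have [] := augmentP metric_d L x set0 q0.
- by move=> i; rewrite subrr normr0.
- by move=> i; rewrite setDv inE.
- by move=> i i'; rewrite setDv inE.
Qed.

(** * Amortized accounting of the recourse *)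

Lemma frac_recourseS (s : nat -> frac_step R M) t :
  frac_recourse s t.+1 =
  frac_recourse s t + \sum_i `|frac_x (s t.+1) i - frac_x_at s t i|.
Proof. by rewrite /frac_recourse big_nat_recr. Qed.

Lemma recourseS (S : nat -> {set M}) t :
  recourse S t.+1 = (recourse S t + #|symdiff (S t.+1) (S t)|)%N.
Proof. by rewrite /recourse big_nat_recr. Qed.

Lemma symdiff_sub (A B : {set M}) : B \subset A ->
  symdiff A B = A :\: B.
Proof. by rewrite -setD_eq0 /symdiff => /eqP->; rewrite setU0. Qed.

Lemma card_symdiff_le (A B : {set M}) : (#|symdiff A B| <= #|A| + #|B|)%N.
Proof.
apply: leq_trans (leq_card_setU _ _) _.
by rewrite leq_add // subset_leq_card // subsetDl.
Qed.

(* Mass moved during finished phases pays at rate [16 * L.+2]; the current phase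
   has only cost its insertions. *)
Definition paid (s : nat -> frac_step R M) (t : nat) : Prop :=
  exists m xb Sb tag, [/\ phase (frac_x_at s t) (run rounding s t) m xb Sb tag,
    #|run rounding s t|%:R <= 11 * k' &
    (recourse (run rounding s) t)%:R <=
      16 * L.+2%:R * (frac_recourse s t - \sum_i m i)
      + #|run rounding s t :\: Sb|%:R].

Lemma paid0 s : paid s 0.
Proof.
exists (fun=> 0), (fun=> 0), set0, (fun=> ord0); split.
- split=> //.
  + by rewrite cards0 mulr_ge0 // ltW.
  (* The zero vector has no heavy ball, so the empty set covers all of them. *)
  + by move=> l j; rewrite /ball_mass big1 // => ?; lra.
  + by move=> i; rewrite subrr normr0.
  + by move=> i; rewrite setDv inE.
  + by move=> i i'; rewrite setDv inE.
- by rewrite cards0 mulr_ge0 // ltW.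
- by rewrite /recourse /frac_recourse !big_geq // big1 // subr0 mulr0 add0r ler0n.
Qed.

Lemma paidS s t :
    (forall i, 0 <= frac_x (s t.+1) i) -> \sum_i frac_x (s t.+1) i <= k' ->
  paid s t -> paid s t.+1.
Proof.
move=> x0 xk [m [xb [Sb [tag [ph card rec]]]]].
set x := frac_x (s t.+1) in x0 xk.
have [tag' ph'] := phase_augment x ph.
have ins' := phase_insertions ph'.
have h0 : 0 < 2^-1 :> R by lra.
have [_ [ntag [nsub _ _ _]]] := augmentP metric_d L x (run rounding s t) h0.
rewrite /paid recourseS frac_recourseS -/x run_roundingS /rounding_step -/x.
set S := run rounding s t in ph card rec ph' ins' nsub *.
set S' := augment d L 2^-1 x S in ph' ins' nsub *.
set m' := fun i => _ in ph' ins'.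
have summ' : \sum_i m' i = \sum_i m i + \sum_i `|x i - frac_x_at s t i|.
  by rewrite -big_split.
case: ifPn => [le_card|].
  exists m', xb, Sb, tag'; split=> //.
  rewrite symdiff_sub // summ' natrD.
  have cardE : #|S' :\: Sb|%:R = #|S :\: Sb|%:R + #|S' :\: S|%:R :> R.
    rewrite -natrD -cardsUI; congr _%:R.
    have -> : (S :\: Sb) :&: (S' :\: S) = set0.
      by apply/setP => i; rewrite !inE; case: (i \in S); rewrite ?andbF.
    rewrite cards0 addn0; apply: eq_card => i; rewrite !inE.
    case: (boolP (i \in Sb)) => [/(subsetP (phase_sub ph))->//|_] /=.
    by case: (boolP (i \in S)) => [/(subsetP nsub)->//|_] /=.
  rewrite cardE; lra.
(* Restart: let n be the size of [S' :\: Sb]. Then n > 11k' - 4k' = 7k', so the at most 15k' changes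
   are fewer than 3n. With the at most n insertions still unpaid this is at most 4n, and n is at
   most [4 * L.+2] times the movement of the phase: hence the rate 16. *)
rewrite -ltNge => gt_card.
have /= phN := phase_restart x0 xk; set S0 := augment d L 4^-1 x set0 in phN *.
exists (fun=> 0), x, S0, (fun=> ord0); split=> //.
  by apply: le_trans (phase_card phN) _; rewrite ler_pM2r // ler_nat.
rewrite setDv cards0 (big1 _ _ (fun=> 0)) // subr0 natrD.
have symd : #|symdiff S0 S|%:R <= #|S0|%:R + #|S|%:R :> R.
  by rewrite -natrD ler_nat card_symdiff_le.
have insS : #|S :\: Sb|%:R <= #|S' :\: Sb|%:R :> R.
  by rewrite ler_nat subset_leq_card // setSD.
have insS' : #|S'|%:R <= #|S' :\: Sb|%:R + #|Sb|%:R :> R.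
  rewrite -natrD ler_nat -(cardsID Sb S') addnC leq_add2l.
  by rewrite subset_leq_card // subsetIr.
have := k'_gt0; have := phase_card ph; have := phase_card phN.
by rewrite summ' in ins'; lra.
Qed.

Lemma roundingP s T :
    (forall t, (1 <= t <= T)%N ->
      (forall i, 0 <= frac_x (s t) i) /\ \sum_i frac_x (s t) i <= k') ->
  (forall t, (1 <= t <= T)%N -> #|run rounding s t|%:R <= 11 * k') /\
  (recourse (run rounding s) T)%:R <= 16 * L.+2%:R * frac_recourse s T.
Proof.
move=> valid; have inv t : (t <= T)%N -> paid s t.
  elim: t => [_|t IH tT]; first exact: paid0.
  by have [x0 xk] := valid t.+1 tT; apply: paidS => //; apply/IH/ltnW.
split=> [t /andP[_ /inv [? [? [? [? []]]]]] //|].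
have [m [xb [Sb [tag [ph _ rec]]]]] := inv T (leqnn T).
(* The insertions of the unfinished phase cost at rate 4, within the rate 16 not yet charged to its
   movement. *)
have := phase_insertions ph.
have : 0 <= L.+2%:R * \sum_i m i.
  by rewrite mulr_ge0 // sumr_ge0 // => i _; apply: le_trans (phase_move ph i).
lra.
Qed.

End Rounding.

(** * Connection cost, by Markov's inequality *)

Section ConnectionCost.
Variables (R : realType) (M : finType) (d : M -> M -> R).
Hypothesis metric_d : is_metric d.
Hypothesis dist_ge1 : forall i j, i != j -> 1 <= d i j.

(** Mass outside the ball pays at least [r'] per unit, so it is at most 1/2. Separating [r'] from
    [r] allows radius 0 with [r' = 1], and a ball containing every point with any positive [r']. *)
Lemma markov_ball_mass (x y : M -> R) j r r' :
    (forall i, 0 <= y i) -> (forall i, y i <= x i) -> 1 <= \sum_i y i ->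
    0 < r' -> (forall i, r < d i j -> r' <= d i j) ->
    2 * \sum_i d i j * y i <= r' ->
  2^-1 <= ball_mass d x j r.
Proof.
move=> y0 yx y1 r'0 gap cr'.
apply: le_trans (ball_mass_le _ _ _ yx).
set out := \sum_(i | ~~ (d i j <= r)) y i.
have sumE : \sum_i y i = ball_mass d y j r + out.
  by rewrite (bigID (fun i => d i j <= r)).
have : r' * out <= \sum_i d i j * y i.
  rewrite mulr_sumr [X in _ <= X](bigID (fun i => d i j <= r)) /=.
  apply: le_trans (_ : \sum_(i | ~~ (d i j <= r)) d i j * y i <= _).
    by apply: ler_sum => i; rewrite -ltNge => /gap ?; rewrite ler_wpM2r.
  by rewrite lerDr sumr_ge0 // => i _; rewrite mulr_ge0 ?(dist_ge0 metric_d).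
move=> outc; have : r' * out <= r' * 2^-1 by lra.
by rewrite ler_pM2l // => ?; lra.
Qed.

Lemma heavy_covered_near L (x y : M -> R) (S : {set M}) j :
    (forall i, d i j <= 2 ^+ L) ->
    (forall i, 0 <= y i) -> (forall i, y i <= x i) -> 1 <= \sum_i y i ->
    heavy_covered d L 2^-1 x S ->
  exists2 i, i \in S & d i j <= 8 * \sum_i d i j * y i.
Proof.
move=> dL y0 yx y1 cov; set c := \sum_i _.
have c0 : 0 <= c by apply: sumr_ge0 => i _; rewrite mulr_ge0 ?(dist_ge0 metric_d).
suff [l hv rl] : exists2 l : 'I_L.+2,
    2^-1 <= ball_mass d x j (radius R l) & radius R l <= 4 * c.
  have /existsP[i /andP[iS ij]] := cov l j hv.
  by exists i => //; apply: le_trans ij _; lra.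
have [c2|c2] := lerP (2 * c) 1.
  exists ord0; last by rewrite /=; lra.
  apply: (markov_ball_mass y0 yx y1 ltr01) => // i /= ij.
  by apply: dist_ge1; apply: contraTneq ij => ->; rewrite (Defs.metricxx metric_d) ltxx.
(* The least scale with 2c at most 2^n, capped at [L] because c may exceed every radius. *)
have exn : exists n, (2 * c <= 2 ^+ n) || (L <= n)%N.
  by exists L; rewrite leqnn orbT.
case: (ex_minnP exn) => n Pn minn.
have nL : (n <= L)%N by apply: minn; rewrite leqnn orbT.
have nL2 : (n.+1 < L.+2)%N by [].
exists (Ordinal nL2) => /=.
  case: (lerP (2 * c) (2 ^+ n)) Pn => [cn _|cn /= Ln].
    by apply: (markov_ball_mass y0 yx y1 _ _ cn) => [|i /ltW//]; rewrite exprn_gt0.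
  (* At the cap no point lies outside the ball, so the gap condition is vacuous. *)
  apply: (@markov_ball_mass x y j _ (2 * c)) => //; first by lra.
  move=> i; rewrite ltNge (le_trans (dL i)) // ler_weXn2l //; lra.
(* Minimality gives 2^(n-1) < 2c, hence radius at most 4c; for n = 0 the radius is 1 and 2c > 1. *)
case: n Pn minn nL nL2 => [|n] _ minn nL _; first by rewrite expr0; lra.
have := minn n; rewrite ltnn; case: lerP => /= [_ /(_ isT)//|cn _].
by rewrite exprS; lra.
Qed.

Lemma connection_cost_le L k beta k' (s : frac_step R M) (S : {set M}) :
    (forall i j, d i j <= 2 ^+ L) -> frac_valid d k beta k' s ->
    heavy_covered d L 2^-1 (frac_x s) S ->
  (connection_cost d (clients s) S
    <= (11 * beta)%:E * OPT d k (clients s))%E.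
Proof.
move=> dL [_ [y0 [ycov [yx [_ cost]]]]] cov.
have cost0 : 0 <= assignment_cost d (clients s) (frac_y s).
  apply: sumr_ge0 => i _; apply: sumr_ge0 => j jC.
  by rewrite mulr_ge0 ?(dist_ge0 metric_d) ?y0.
apply: (@le_trans _ _ (8 * assignment_cost d (clients s) (frac_y s))%:E).
  rewrite /connection_cost /assignment_cost exchange_big /= mulr_sumr -sumEFin.
  apply: lee_sum => j jC.
  have [i iS ij] := heavy_covered_near (dL^~ j)
    (fun i => y0 i j jC) (fun i => yx i j jC) (ycov j jC) cov.
  apply: le_trans (bigmin_le_cond _ (fun i => (d i j)%:E) iS) _.
  by rewrite lee_fin.
rewrite [(11 * beta)%:E]EFinM -muleA.
(* The factor 8 is relaxed to 11, as the cost is nonnegative. *)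
apply: (@le_trans _ _ (11%:E * (assignment_cost d (clients s) (frac_y s))%:E)%E).
  by rewrite -EFinM lee_fin; lra.
by rewrite lee_wpmul2l // lee_fin; lra.
Qed.

End ConnectionCost.

(** * The diameter and the final constant *)

Lemma le_max_distance (R : realType) (M : finType) (d : M -> M -> R) i j :
  d i j <= max_distance d.
Proof.
apply: le_trans (le_bigmax _ (fun i => \big[Order.max/0]_(j : M) d i j) i).
exact: (le_bigmax _ (d i)).
Qed.

Theorem theorem5 (R : realType) :
  exists c : R, 0 < c /\
  forall (M : finType) (d : M -> M -> R),
    is_metric d -> min_nonzero_distance d 1 ->
  forall (k : nat) (beta k' : R), 1 <= beta -> 0 < k' ->
  exists A : online_algorithm R M,
  forall (T : nat) (s : nat -> frac_step R M),
    (forall t, (1 <= t <= T)%N -> frac_valid d k beta k' (s t)) ->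
    (forall t, (1 <= t <= T)%N ->
       #|run A s t|%:R <= 11 * k' /\
       (connection_cost d (clients (s t)) (run A s t)
          <= (11 * beta)%:E * OPT d k (clients (s t)))%E) /\
    (recourse (run A s) T)%:R
      <= c * (1 + ln (max_distance d)) * frac_recourse s T.
Proof.
have ln2_inv : 0 < (ln 2)^-1 :> R by rewrite invr_gt0 ln2_gt0.
(* With u = ln D and v = 1/ln 2, [L.+2] is at most 3 + uv, which is at most (3 + v)(1 + u). *)
exists (16 * (3 + (ln 2)^-1)); split; first by lra.
move=> M d metric_d [[i0 [j0 [_ d1]]] dist_ge1] k beta k' _ k'0.
set D := max_distance d; set L := top_scale D.
have D1 : 1 <= D by rewrite -d1 le_max_distance.
have dL i j : d i j <= 2 ^+ L.
  exact: le_trans (le_max_distance d i j) (le_pow2_top_scale D1).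
exists (rounding d L k') => T s valid.
have [|card rec] := roundingP metric_d L k'0 (s := s) (T := T).
  by move=> t /valid[x0 [_ [_ [_ []]]]].
split=> [t tT|].
  split; first exact: card.
  apply: connection_cost_le (valid t tT) _ => //.
  by case: t tT => // t _; rewrite run_roundingS; apply: rounding_step_covered.
apply: le_trans rec _; apply: ler_wpM2r.
  by apply: sumr_ge0 => t _; apply: sumr_ge0.
rewrite -[leRHS]mulrA ler_pM2l //.
have := top_scale_le D1; have := ln_ge0 D1; rewrite -/L -[L.+2]addn2 natrD.
set u := ln D => u0; set v := (ln 2)^-1 in ln2_inv *.
have : 0 <= u * v by rewrite mulr_ge0 // ltW.
by lra.
Qed.
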